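(* Let $G$ be a simple connected graph, let $M\in\{A,L,Q\}$, and let $\mathbf{u}$ be a fixed state in $G$ relative to $M$ satisfying $\mathbf{1}^T\mathbf{u}=0$. Then, for every $t\in\mathbb{R}$, $$U_{M(G\overline{G})}(t)\,[\mathbf{u},\mathbf{0}]^T=\alpha(t)\,[\mathbf{u},\mathbf{0}]^T+\beta(t)\,[\mathbf{0},\mathbf{u}]^T$$ for some complex-valued functions $\alpha(t)$ and $\beta(t)$.
   Context: For a finite simple graph $G$, $A(G)$ is the adjacency matrix, $D$ the diagonal degree matrix, $L(G)=D-A(G)$ the Laplacian and $Q(G)=D+A(G)$ the signless Laplacian. $U_{M(G)}(t)=\exp(itM(G))$. A state is a real unit vector indexed by the vertices; a fixed state in $G$ relative to $M$ is a state that is an eigenvector of $M(G)$. $\mathbf{1}$ is the all-ones vector. The complementary prism $G\overline{G}$ is obtained from the disjoint union of $G$ and its complement $\overline{G}$ (whose vertices are relabelled $a'$ for $a\in V(G)$) by adding an edge between each vertex $a$ of $G$ and its copy $a'$ in $\overline{G}$. Its vertices are ordered with $V(G)$ first and then $V(\overline{G})$ in the corresponding order; $[\mathbf{x},\mathbf{y}]^T$ denotes the column vector equal to $\mathbf{x}$ on $V(G)$ and $\mathbf{y}$ on $V(\overline{G})$. *)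

(* Defs.v *)
From HB Require Import structures.
From mathcomp Require Import all_boot all_order all_algebra complex.
From mathcomp Require Import classical_sets reals topology normedtype sequences.

Set Implicit Arguments.
Unset Strict Implicit.
Unset Printing Implicit Defensive.

Import Order.TTheory GRing.Theory Num.Theory numFieldNormedType.Exports.

Local Open Scope ring_scope.
Local Open Scope classical_set_scope.
Local Open Scope complex_scope.

Record sgraph (n : nat) := SGraph {
  adj :> rel 'I_n;
  adj_sym : symmetric adj;
  adj_irr : irreflexive adj
}.

(* The graph without vertices is not considered connected. *)
Definition gconnected n (G : sgraph n) : bool :=
  (0 < n)%N && [forall x, forall y, connect G x y].

Definition compl_adj n (G : sgraph n) : rel 'I_n :=
  fun x y => (x != y) && ~~ G x y.

Fact compl_adj_sym n (G : sgraph n) : symmetric (compl_adj G).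
Proof. by move=> x y; rewrite /compl_adj eq_sym adj_sym. Qed.

Fact compl_adj_irr n (G : sgraph n) : irreflexive (compl_adj G).
Proof. by move=> x; rewrite /compl_adj eqxx. Qed.

Definition compl n (G : sgraph n) : sgraph n :=
  SGraph (compl_adj_sym G) (compl_adj_irr G).

(* In the complementary prism, vertex a of G is lshift n a and its copy a' in
   the complement is rshift n a. *)
Definition cprism_adj n (G : sgraph n) : rel 'I_(n + n) :=
  fun x y => match split x, split y with
             | inl a, inl b => G a b
             | inr a, inr b => compl G a b
             | inl a, inr b | inr a, inl b => a == b
             end.

Fact cprism_adj_sym n (G : sgraph n) : symmetric (cprism_adj G).
Proof.
move=> x y; rewrite /cprism_adj.
by case: (split x) => a; case: (split y) => b; rewrite 1?eq_sym // adj_sym.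
Qed.

Fact cprism_adj_irr n (G : sgraph n) : irreflexive (cprism_adj G).
Proof. by move=> x; rewrite /cprism_adj; case: (split x) => a; exact: adj_irr. Qed.

Definition cprism n (G : sgraph n) : sgraph (n + n) :=
  SGraph (cprism_adj_sym G) (cprism_adj_irr G).

Definition adjmx (R : pzRingType) n (G : sgraph n) : 'M[R]_n :=
  \matrix_(i, j) (G i j)%:R.

Definition degmx (R : pzRingType) n (G : sgraph n) : 'M[R]_n :=
  diag_mx (\row_i #|[set j | G i j]%SET|%:R).

Variant mxkind := Adjacency | Laplacian | SignlessLaplacian.

Definition graphmx (R : pzRingType) (M : mxkind) n (G : sgraph n) : 'M[R]_n :=
  match M with
  | Adjacency => adjmx R G
  | Laplacian => degmx R G - adjmx R G
  | SignlessLaplacian => degmx R G + adjmx R G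
  end.

(* The unit length is Euclidean (the library norm on matrices is the sup norm). *)
Definition state (R : realType) n (u : 'cV[R]_n) : Prop :=
  \sum_i u i 0 ^+ 2 = 1.

(* A state is nonzero, so the second conjunct says that u is an eigenvector. *)
Definition fixed_state (R : realType) (M : mxkind) n (G : sgraph n)
    (u : 'cV[R]_n) : Prop :=
  state u /\ exists lambda : R, graphmx R M G *m u = lambda *: u.

Definition expmx (K : numFieldType) n (A : 'M[K]_n) : 'M[K]_n :=
  limn (series (fun k => (k`!%:R)^-1 *: A ^+ k)).

Definition cplxmx (R : realType) m n (A : 'M[R]_(m, n)) : 'M[R[i]]_(m, n) :=
  map_mx (real_complex R) A.

Definition transition (R : realType) (M : mxkind) n (G : sgraph n) (t : R) :
    'M[R[i]]_n :=
  expmx ((0 +i* t) *: cplxmx (graphmx R M G)).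

(* Main.v *)
Require Import Defs.
From HB Require Import structures.
From mathcomp Require Import all_boot all_order all_algebra complex boolp.
From mathcomp Require Import classical_sets reals topology normedtype sequences.

Set Implicit Arguments.
Unset Strict Implicit.
Unset Printing Implicit Defensive.

Import Order.TTheory GRing.Theory Num.Theory numFieldNormedType.Exports.

Local Open Scope ring_scope.
Local Open Scope complex_scope.

(** The plane spanned by [u, 0] and [0, u] is invariant under the matrix of the
    complementary prism.  Each of A, L, Q is a combination e D + f A with fixed
    scalars e and f, so the matrix of the prism has the block form

      | M(G) + e      f            |
      |    f      M(compl G) + e   |

    Moreover A(compl G) = J - 1 - A(G), with J the all-ones matrix, and
    D(compl G) = (n - 1) - D(G).  Since u is orthogonal to the all-ones vector,
    J u = 0, so that M(compl G) u = (e (n - 1) - f) u - M(G) u: the eigenvector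
    u of M(G) is also an eigenvector of M(compl G).  All four blocks therefore
    act on u as scalars ([graphmx_cprism_stable]).

    A subspace invariant under a matrix is invariant under its powers, hence
    under the partial sums of the exponential series, hence under the
    exponential, because a subspace of a finite-dimensional space is closed
    ([expmx_stable]).  A subspace is handled as the column space of a matrix W,
    and its invariance under A as the existence of B with A W = W B; here
    W = block_mx u 0 0 u. *)

Lemma mulmx_entry_continuous (K : numFieldType) p m n q (P : 'M[K]_(p, m))
    (Q : 'M[K]_(n, q)) i j :
  continuous (fun X : 'M[K]_(m, n) => (P *m X *m Q) i j).
Proof.
have -> : (fun X : 'M[K]_(m, n) => (P *m X *m Q) i j) =
    (fun X => \sum_l (\sum_k P i k * X k l) * Q l j).
  by apply/funext => X; rewrite mxE; under eq_bigr do rewrite mxE.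
move=> X; have FX := nbhs_filter X.
apply: cvg_big => [|l _]; first exact: add_continuous.
apply: cvgMr_tmp; apply: cvg_big => [|k _]; first exact: add_continuous.
by apply: cvgMl_tmp; exact: coord_continuous.
Qed.

(** A homogeneous linear condition is closed, hence passes to limits.  If S
    diverges, [limn S] is the default value 0, for which the condition is
    trivial. *)
Lemma limn_mulmx0 (K : numFieldType) p m n q (P : 'M[K]_(p, m))
    (Q : 'M[K]_(n, q)) (S : nat -> 'M[K]_(m, n)) :
  (forall k, P *m S k *m Q = 0) -> P *m limn S *m Q = 0.
Proof.
move=> PSQ; have [Scvg|Sdvg] := EM (cvgn S); last first.
  have pt0 : (point : 'M[K]_(m, n)) = 0 by apply/matrixP => i j; rewrite !mxE.
  by rewrite (dvgP Sdvg) pt0 mulmx0 mul0mx.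
apply/matrixP => i j; rewrite [RHS]mxE.
have : ((P *m S k *m Q) i j @[k --> \oo] --> (P *m limn S *m Q) i j)%classic.
  apply: (cvg_comp S (fun X => (P *m X *m Q) i j) Scvg).
  exact: mulmx_entry_continuous.
have -> : (fun k => (P *m S k *m Q) i j) = fun=> 0.
  by apply/funext => k; rewrite PSQ mxE.
by move=> PlQ; apply: (cvg_unique (@norm_hausdorff _ K) PlQ); exact: cvg_cst.
Qed.

(** Membership in the column space of W is expressed as being killed by a matrix
    N, so that stability of the column space becomes the equation
    N X W = 0 in X, to which [limn_mulmx0] applies. *)
Lemma expmx_stable (K : numFieldType) m r (A : 'M[K]_m) (W : 'M[K]_(m, r))
    (B : 'M[K]_r) :
  A *m W = W *m B -> exists C : 'M[K]_r, expmx A *m W = W *m C.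
Proof.
move=> AW; pose N := (cokermx W^T)^T.
have NW : N *m W = 0 by rewrite -[W]trmxK -trmx_mul mulmx_coker trmx0.
have AkW k : A ^+ k *m W = W *m B ^+ k.
  elim: k => [|k IHk]; first by rewrite !expr0 mulmx1 mul1mx.
  by rewrite !exprSr -!mulmxE -mulmxA AW !mulmxA IHk.
have NEW : N *m expmx A *m W = 0.
  apply: limn_mulmx0 => k; rewrite -mulmxA /series /= mulmx_suml mulmx_sumr.
  apply: big1 => l _.
  by rewrite -scalemxAl AkW -scalemxAr mulmxA NW mul0mx scaler0.
have /submxP[D DE] : ((expmx A *m W)^T <= W^T)%MS.
  by rewrite submxE -[cokermx _]trmxK -trmx_mul mulmxA NEW trmx0.
by exists D^T; rewrite -[LHS]trmxK DE trmx_mul trmxK.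
Qed.

(** The scalars e and f depend on M only: the three kinds of matrices can be
    treated at once, and compared between G, its complement and the prism. *)
Lemma graphmx_comb (R : pzRingType) (M : mxkind) : exists e f : R,
  forall n (G : sgraph n), graphmx R M G = e *: degmx R G + f *: adjmx R G.
Proof.
case: M; [exists 0, 1 | exists 1, (-1) | exists 1, 1] => n G /=.
- by rewrite scale0r add0r scale1r.
- by rewrite scale1r scaleN1r.
- by rewrite !scale1r.
Qed.

(** Degrees as row sums: this reduces the degrees in the complement and in the
    prism to block computations on adjacency matrices. *)
Lemma degmxE (R : pzRingType) n (G : sgraph n) :
  degmx R G = diag_mx (adjmx R G *m const_mx 1 : 'cV_n)^T.
Proof.
congr diag_mx; apply/rowP => i; rewrite !mxE.
rewrite -sum1_card natr_sum big_mkcond; apply: eq_bigr => j _.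
by rewrite !mxE inE mulr1; case: (G i j).
Qed.

Lemma adjmx_compl (R : pzRingType) n (G : sgraph n) :
  adjmx R (compl G) = const_mx 1 - 1%:M - adjmx R G.
Proof.
apply/matrixP => i j; rewrite !mxE /= /compl_adj.
have [->|_] := eqVneq i j; first by rewrite adj_irr /= subrr subr0.
by case: (G i j); rewrite /= subr0 ?subrr ?subr0.
Qed.

Lemma degmx_compl (R : pzRingType) n (G : sgraph n) :
  degmx R (compl G) = (n%:R - 1)%:M - degmx R G.
Proof.
rewrite !degmxE adjmx_compl !mulmxBl mul1mx.
have -> : (const_mx 1 : 'M[R]_n) *m const_mx 1 = const_mx n%:R :> 'cV[R]_n.
  apply/colP => i; rewrite !mxE -[n in RHS]card_ord -sumr_const.
  by apply: eq_bigr => j _; rewrite !mxE mulr1.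
apply/matrixP => i j; by rewrite !mxE -mulrnBl; congr (_ *+ _).
Qed.

Lemma adjmx_cprism (R : pzRingType) n (G : sgraph n) :
  adjmx R (cprism G) = block_mx (adjmx R G) 1%:M 1%:M (adjmx R (compl G)).
Proof.
apply/matrixP => x y; rewrite !mxE /= /cprism_adj.
by case: (split x) => a; rewrite !mxE; case: (split y) => b; rewrite !mxE.
Qed.

Lemma degmx_cprism (R : pzRingType) n (G : sgraph n) :
  degmx R (cprism G) =
    block_mx (degmx R G + 1%:M) 0 0 (degmx R (compl G) + 1%:M).
Proof.
rewrite !degmxE adjmx_cprism -col_mx_const mul_block_col !mul1mx.
rewrite tr_col_mx diag_mx_row; congr block_mx.
- by rewrite raddfD /= raddfD /= trmx_const diag_const_mx.
- by rewrite addrC raddfD /= raddfD /= trmx_const diag_const_mx.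
Qed.

(** The matrix B is explicit: its diagonal entries are lambda + e and mu + e,
    where mu is the eigenvalue of u in the complement, and its off-diagonal
    entries, which come from the edges joining a to its copy, are f. *)
Lemma graphmx_cprism_stable (R : comPzRingType) (M : mxkind) n (G : sgraph n)
    (u : 'cV[R]_n) (lambda : R) :
  graphmx R M G *m u = lambda *: u -> (const_mx 1 : 'cV[R]_n)^T *m u = 0 ->
  exists B : 'M[R]_(1 + 1),
    graphmx R M (cprism G) *m block_mx u 0 0 u = block_mx u 0 0 u *m B.
Proof.
have [e [f Mef]] := graphmx_comb R M => Gu u1.
pose mu := e * (n%:R - 1) - f - lambda.
have Ju : (const_mx 1 : 'M[R]_n) *m u = 0.
  by apply/row_matrixP => i; rewrite row_mul row_const -trmx_const u1 row0.
have Gbaru : graphmx R M (compl G) *m u = mu *: u.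
  rewrite Mef degmx_compl adjmx_compl !scalerBr.
  rewrite [X in X *m u](_ : _ = e *: (n%:R - 1)%:M + f *: const_mx 1
     - f *: 1%:M - graphmx R M G); last first.
    rewrite Mef opprD !addrA; congr (_ - _).
    by rewrite [RHS]addrAC; congr (_ - _); rewrite addrAC.
  rewrite !mulmxBl mulmxDl -!scalemxAl Ju mul1mx mul_scalar_mx Gu.
  by rewrite scaler0 addr0 scalerA -!scalerBl.
exists (block_mx (lambda + e)%:M f%:M f%:M (mu + e)%:M).
have -> : graphmx R M (cprism G) = block_mx (graphmx R M G + e%:M) f%:M f%:M
    (graphmx R M (compl G) + e%:M).
  rewrite Mef degmx_cprism adjmx_cprism !scale_block_mx add_block_mx.
  rewrite !scalerDr !scaler0 !add0r !scalemx1 ![_ + _%:M + _]addrAC.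
  by rewrite -!Mef.
rewrite !mulmx_block !mulmx0 !mul0mx !addr0 !add0r !mulmxDl Gu Gbaru.
by rewrite !mul_scalar_mx !mul_mx_scalar !scalerDl.
Qed.

Theorem theorem7 (R : realType) (n : nat) (G : sgraph n) (M : mxkind)
    (u : 'cV[R]_n) (G_connected : gconnected G) (u_fixed : fixed_state M G u)
    (u_orth : (const_mx 1 : 'cV[R]_n)^T *m u = 0) :
  exists alpha beta : R -> R[i], forall t : R,
    transition M (cprism G) t *m cplxmx (col_mx u 0)
    = alpha t *: cplxmx (col_mx u 0) + beta t *: cplxmx (col_mx 0 u).
Proof.
have [_ [lambda Gu]] := u_fixed.
have [B MW] := graphmx_cprism_stable Gu u_orth.
pose W := cplxmx (block_mx u 0 0 u).
(* Multiplying by i t preserves the invariance of the column space of W. *)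
have UW t : exists C : 'M[R[i]]_(1 + 1),
    transition M (cprism G) t *m W = W *m C.
  apply: (@expmx_stable _ _ _ _ _ ((0 +i* t) *: cplxmx B)).
  by rewrite -scalemxAl -scalemxAr -!map_mxM MW.
have /choice[C CE] := UW.
(* [u, 0] is the first column of W, so the coefficients of its image are the
   entries of the first column of C t. *)
exists (fun t => usubmx (lsubmx (C t)) 0 0),
  (fun t => dsubmx (lsubmx (C t)) 0 0).
move=> t; have := congr1 lsubmx (CE t).
have -> : W = row_mx (cplxmx (col_mx u 0)) (cplxmx (col_mx 0 u)).
  by rewrite /W -map_row_mx block_mxEh.
rewrite mul_mx_row row_mxKl => ->.
rewrite -mulmx_lsub -[in LHS](vsubmxK (lsubmx (C t))) mul_row_col.
by rewrite [in LHS](mx11_scalar (usubmx _))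
  [in LHS](mx11_scalar (dsubmx _)) !mul_mx_scalar.
Qed.
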